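(* Let $k\geq 1$ be an integer, and let $\mathcal{A}_k$ be a multiple saddle-point matrix with blocks $A_0,\dots,A_k$, $B_1,\dots,B_k$ as described in the context, where $A_0$ is symmetric positive definite, $A_1,\dots,A_k$ are symmetric positive semi-definite, and $\ker(A_j)\cap\ker(B_j^T)=\{0\}$ for $j=1,\dots,k$. Let $\widehat{S}_k\in\mathbb{R}^{n_k\times n_k}$ be a symmetric positive definite matrix (an approximation to $S_k$), and let $\widehat{\mathcal{P}}_k$ be the preconditioner defined in the context, that is, $\mathcal{P}_k$ with $S_k$ replaced by $\widehat{S}_k$. Then every eigenvalue of the preconditioned matrix $\widehat{\mathcal{P}}_k^{-1}\mathcal{A}_k$ is equal to $1$, or is equal to $-1$, or lies within the range of eigenvalues of $(-1)^k\widehat{S}_k^{-1}S_k$ (i.e. in the closed interval from its smallest to its largest eigenvalue).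
   Context: All matrices are real. Let $n_0,\dots,n_k$ be positive integers, $A_j\in\mathbb{R}^{n_j\times n_j}$ for $j=0,\dots,k$, and $B_j\in\mathbb{R}^{n_j\times n_{j-1}}$ for $j=1,\dots,k$. The matrix $\mathcal{A}_k$ is the symmetric block tridiagonal matrix of dimension $\sum_{j=0}^k n_j$, with block rows and columns indexed by $0,\dots,k$, whose $(j,j)$ block is $(-1)^jA_j$ for $j=0,\dots,k$, whose $(j,j-1)$ block is $B_j$ and whose $(j-1,j)$ block is $B_j^T$ for $j=1,\dots,k$, and whose other blocks are zero. Define the Schur complements $S_0=A_0$ and $S_j=A_j+B_jS_{j-1}^{-1}B_j^T$ for $j=1,\dots,k$; under the assumptions in the claim these are all symmetric positive definite. The preconditioner $\mathcal{P}_k$ is $\mathcal{P}_{L,k}\mathcal{P}_{D,k}^{-1}\mathcal{P}_{U,k}$, where $\mathcal{P}_{D,k}$ is the block diagonal matrix with diagonal blocks $S_0,S_1,\dots,S_k$; $\mathcal{P}_{L,k}$ is the block lower bidiagonal matrix whose $(j,j)$ block is $(-1)^jS_j$ for $j=0,\dots,k$, whose $(j,j-1)$ block is $B_j$ for $j=1,\dots,k$, and whose other blocks are zero; and $\mathcal{P}_{U,k}=\mathcal{P}_{L,k}^T$. The preconditioner $\widehat{\mathcal{P}}_k$ is $\widehat{\mathcal{P}}_{L,k}\widehat{\mathcal{P}}_{D,k}^{-1}\widehat{\mathcal{P}}_{U,k}$, where $\widehat{\mathcal{P}}_{L,k}$, $\widehat{\mathcal{P}}_{D,k}$, $\widehat{\mathcal{P}}_{U,k}$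 are obtained from $\mathcal{P}_{L,k}$, $\mathcal{P}_{D,k}$, $\mathcal{P}_{U,k}$ by replacing $S_k$ with $\widehat{S}_k$ in the last diagonal block of each (so these last diagonal blocks become $(-1)^k\widehat{S}_k$, $\widehat{S}_k$, $(-1)^k\widehat{S}_k$ respectively), all other blocks being unchanged. *)

(* Defs.v *)
From HB Require Import structures.
From mathcomp Require Import all_boot all_order all_algebra.
From mathcomp Require Import reals.
From mathcomp Require Import complex.

Set Implicit Arguments.
Unset Strict Implicit.
Unset Printing Implicit Defensive.

Import Order.TTheory GRing.Theory Num.Theory.
Local Open Scope ring_scope.
Local Open Scope complex_scope.

Definition posdefmx (R : realType) (m : nat) (M : 'M[R]_m) : Prop :=
  M \is symmetricmx /\ forall v : 'cV[R]_m, v != 0 -> 0 < (v^T *m M *m v) 0 0.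

Definition possemidefmx (R : realType) (m : nat) (M : 'M[R]_m) : Prop :=
  M \is symmetricmx /\ forall v : 'cV[R]_m, 0 <= (v^T *m M *m v) 0 0.

(* Block families are indexed by all of nat, but only n j, A j for j <= k and
   B j for 1 <= j <= k are ever used; B 0 is a dummy. In the blocks below,
   conform_mx 0 is a mere cast: the dimensions agree wherever it is reached. *)

Definition lower_bidiag_block (R : realType) (n : nat -> nat)
    (D : forall j : nat, 'M[R]_(n j)) (B : forall j : nat, 'M[R]_(n j, n j.-1))
    (i j : nat) : 'M[R]_(n i, n j) :=
  if i == j then conform_mx 0 ((-1) ^+ i *: D i)
  else if i == j.+1 then conform_mx 0 (B i)
  else 0.

Definition saddle_block (R : realType) (n : nat -> nat)
    (A : forall j : nat, 'M[R]_(n j)) (B : forall j : nat, 'M[R]_(n j, n j.-1))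
    (i j : nat) : 'M[R]_(n i, n j) :=
  if i == j then conform_mx 0 ((-1) ^+ i *: A i)
  else if i == j.+1 then conform_mx 0 (B i)
  else if j == i.+1 then conform_mx 0 (B j)^T
  else 0.

Definition saddle_mx (R : realType) (n : nat -> nat)
    (A : forall j : nat, 'M[R]_(n j)) (B : forall j : nat, 'M[R]_(n j, n j.-1))
    (k : nat) : 'M[R]_(\sum_(j < k.+1) n j) :=
  \mxblock_(i < k.+1, j < k.+1) saddle_block A B i j.

Fixpoint schur (R : realType) (n : nat -> nat)
    (A : forall j : nat, 'M[R]_(n j)) (B : forall j : nat, 'M[R]_(n j, n j.-1))
    (j : nat) : 'M[R]_(n j) :=
  match j with
  | 0 => A 0
  | i.+1 => A i.+1 + B i.+1 *m invmx (schur A B i) *m (B i.+1)^T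
  end.

Definition precondL (R : realType) (n : nat -> nat)
    (D : forall j : nat, 'M[R]_(n j)) (B : forall j : nat, 'M[R]_(n j, n j.-1))
    (k : nat) : 'M[R]_(\sum_(j < k.+1) n j) :=
  \mxblock_(i < k.+1, j < k.+1) lower_bidiag_block D B i j.

Definition precondD (R : realType) (n : nat -> nat)
    (D : forall j : nat, 'M[R]_(n j))
    (k : nat) : 'M[R]_(\sum_(j < k.+1) n j) :=
  \mxdiag_(j < k.+1) D j.

(* P_L P_D^-1 P_U for an arbitrary family D of diagonal blocks: D = schur A B
   gives P_k, and replacing D_k by an approximation gives \hat P_k. *)
Definition precond (R : realType) (n : nat -> nat)
    (D : forall j : nat, 'M[R]_(n j)) (B : forall j : nat, 'M[R]_(n j, n j.-1))
    (k : nat) : 'M[R]_(\sum_(j < k.+1) n j) :=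
  precondL D B k *m invmx (precondD D k) *m (precondL D B k)^T.

(* dfwith S Shat maps k to Shat and every other j to S j. *)
Definition precond_hat (R : realType) (n : nat -> nat)
    (A : forall j : nat, 'M[R]_(n j)) (B : forall j : nat, 'M[R]_(n j, n j.-1))
    (k : nat) (Shat : 'M[R]_(n k)) : 'M[R]_(\sum_(j < k.+1) n j) :=
  precond (dfwith (schur A B) Shat) B k.

(* A real matrix need not be symmetric, so its eigenvalues are taken in R[i]. *)
Definition eigenvalueC (R : realType) (m : nat) (M : 'M[R]_m) (z : R[i]) : bool :=
  eigenvalue (map_mx (real_complex R) M) z.

(* In R[i], x <= y means that Im x = Im y and Re x <= Re y; so lo%:C and hi%:C
   are the smallest and largest eigenvalues of M, all eigenvalues of M are real,
   and z is a real number of the closed interval [lo, hi]. *)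
Definition in_eigenvalue_range (R : realType) (m : nat) (M : 'M[R]_m) (z : R[i]) :
    Prop :=
  exists lo hi : R,
    [/\ eigenvalueC M lo%:C, eigenvalueC M hi%:C,
        forall w : R[i], eigenvalueC M w -> lo%:C <= w <= hi%:C
      & lo%:C <= z <= hi%:C].

(* Main.v *)
Require Import Defs.
From HB Require Import structures.
From mathcomp Require Import all_boot all_order all_algebra.
From mathcomp Require Import reals.
From mathcomp Require Import complex.
From mathcomp Require Import lra.

Set Implicit Arguments.
Unset Strict Implicit.
Unset Printing Implicit Defensive.

Import Order.TTheory GRing.Theory Num.Theory.
Local Open Scope ring_scope.
Local Open Scope complex_scope.

(** With the diagonal signs kept in the factors, both matrices factor through
    the same block lower bidiagonal matrix L, which has diagonal blocks
    (-1)^j D_j (where D_j = S_j for j < k and D_k = Shat) and subdiagonal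
    blocks B_j:

      - the preconditioner is L diag(D_j)^-1 L^T by definition;
      - the saddle-point matrix is
          L diag((-1)^j D_j^-1 S_j D_j^-1) L^T                [saddle_factor],
        because the block in position (j, j) of this product is
        (-1)^j S_j + (-1)^(j-1) B_j S_(j-1)^-1 B_j^T = (-1)^j A_j, by the
        recursion that defines the Schur complements.

    With U = diag(D_j)^-1 L^T the preconditioned matrix is therefore
    U^-1 diag((-1)^j D_j^-1 S_j) U, so its eigenvalues are those of the blocks
    (-1)^j D_j^-1 S_j [eigenvalue_precond_saddle].  For j < k the block is
    plus or minus the identity, which gives the eigenvalues 1 and -1; for
    j = k it is (-1)^k Shat^-1 S_k itself.

    Two facts complete the argument.  The Schur complements are symmetric
    positive definite [schur_posdef], which makes all D_j invertible.  The
    eigenvalues of Shat^-1 (+- S_k) are real, since Shat is positive definite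
    and S_k symmetric [pencil_eigenvalue_real]; being real and finitely many,
    they have a least and a greatest element, and an eigenvalue lies between
    those two [eigenvalue_range]. *)

(** * Positive definiteness of the Schur complements *)

Lemma unitmx_ker0 (F : fieldType) m (M : 'M[F]_m) :
  (forall x : 'cV_m, M *m x = 0 -> x = 0) -> M \in unitmx.
Proof.
move=> ker0; rewrite -unitmx_tr -row_free_unit -kermx_eq0.
apply/eqP/row_matrixP => i; rewrite row0.
apply: trmx_inj; rewrite trmx0; apply: ker0.
by apply: trmx_inj; rewrite trmx_mul trmxK -row_mul mulmx_ker row0 trmx0.
Qed.

Lemma symmetricmxP (R : realType) m (M : 'M[R]_m) :
  reflect (M^T = M) (M \is symmetricmx).
Proof.
by apply: (iffP (is_hermitianmxP _ _ _)); rewrite expr0 scale1r map_mx_id.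
Qed.

Lemma posdef_unitmx (R : realType) m (M : 'M[R]_m) : posdefmx M -> M \in unitmx.
Proof.
move=> [_ pos]; apply: unitmx_ker0 => x Mx0; apply/eqP.
by apply: contraTT isT => /pos; rewrite -mulmxA Mx0 mulmx0 mxE ltxx.
Qed.

Lemma sqnorm_ge0 (R : realType) m (x : 'cV[R]_m) : 0 <= (x^T *m x) 0 0.
Proof. by rewrite mxE; apply: sumr_ge0 => i _; rewrite mxE -expr2 sqr_ge0. Qed.

Lemma sqnorm_eq0 (R : realType) m (x : 'cV[R]_m) : (x^T *m x) 0 0 = 0 -> x = 0.
Proof.
rewrite mxE => /eqP; rewrite psumr_eq0 => [|i _]; last by rewrite mxE -expr2 sqr_ge0.
move=> /allP x0; apply/colP => i; rewrite mxE; apply/eqP.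
by have := x0 i (mem_index_enum i); rewrite mxE -expr2 sqrf_eq0.
Qed.

(** A zero of the nonnegative quadratic form of M is a minimum, so the form has
    zero derivative there in every direction; the derivative at x in the
    direction M x is twice the squared norm of M x. *)
Lemma possemidef_ker (R : realType) m (M : 'M[R]_m) (x : 'cV[R]_m) :
  possemidefmx M -> (x^T *m M *m x) 0 0 = 0 -> M *m x = 0.
Proof.
move=> [/symmetricmxP symM pos] q0; apply: sqnorm_eq0.
set y := M *m x.
have yT : y^T = x^T *m M by rewrite /y trmx_mul symM.
set a := (y^T *m y) 0 0; set b := (y^T *m M *m y) 0 0.
have a0 : 0 <= a by apply: sqnorm_ge0.
have b0 : 0 <= b by apply: pos.
have quad t : 0 <= t * (a *+ 2 + t * b).
  suff -> : t * (a *+ 2 + t * b) = ((x + t *: y)^T *m M *m (x + t *: y)) 0 0 by [].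
  have -> : (x + t *: y)^T = x^T + t *: y^T by rewrite linearD linearZ.
  rewrite !mulmxDl !mulmxDr -!scalemxAl -!scalemxAr.
  rewrite -yT -[y^T *m M *m x]mulmxA -/y.
  have addE (U V : 'M[R]_1) : (U + V) 0 0 = U 0 0 + V 0 0 by rewrite mxE.
  have scaleE (U : 'M[R]_1) : (t *: U) 0 0 = t * U 0 0 by rewrite mxE.
  rewrite !addE !scaleE yT q0 -yT.
  by rewrite -/a -/b mulr2n !mulrDr add0r addrA.
(* A negative t close enough to 0 makes the linear term dominate unless a = 0;
   t = - a / (b + 1) is small enough, and b + 1 cannot vanish. *)
have b1 : 0 < b + 1 by rewrite ltr_wpDl.
have := quad (- (a / (b + 1))).
rewrite mulNr oppr_ge0 => neg.
apply/eqP; apply: contraTT neg => an0.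
have agt0 : 0 < a by rewrite lt_def an0.
rewrite -ltNge mulr_gt0 ?divr_gt0 //.
rewrite mulr2n mulNr -addrA ltr_wpDl // subr_gt0.
rewrite mulrAC ltr_pdivrMr // mulrDr mulr1.
by rewrite ltrDl.
Qed.

(** The form of the Schur complement at v is that of A at v plus that of S at
    S^-1 B^T v. If it vanishes, both terms do, so v is in the kernel of A (by
    [possemidef_ker]) and in the kernel of B^T. *)
Lemma schur_posdef_step (R : realType) m p (S : 'M[R]_m) (A : 'M[R]_p)
    (B : 'M[R]_(p, m)) :
  posdefmx S -> possemidefmx A ->
  (forall v : 'cV_p, A *m v = 0 -> B^T *m v = 0 -> v = 0) ->
  posdefmx (A + B *m invmx S *m B^T).
Proof.
move=> Spos Apsd ker0; have Su := posdef_unitmx Spos.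
case: (Spos) (Apsd) => [/symmetricmxP symS pos] [/symmetricmxP symA psd].
split.
  apply/symmetricmxP.
  by rewrite linearD /= symA !trmx_mul trmxK trmx_inv symS mulmxA.
move=> v vn0.
set y := invmx S *m (B^T *m v).
have quadE : (v^T *m (A + B *m invmx S *m B^T) *m v) 0 0
    = (v^T *m A *m v) 0 0 + (y^T *m S *m y) 0 0.
  rewrite mulmxDr mulmxDl mxE; congr (_ + _ 0 0).
  rewrite /y !trmx_mul trmxK trmx_inv symS !mulmxA.
  by rewrite mulmxKV.
have y0 : 0 <= (y^T *m S *m y) 0 0.
  have [->|/pos/ltW //] := eqVneq y 0.
  by rewrite mulmx0 mxE.
rewrite quadE lt_def addr_ge0 ?psd // andbT.
apply: contra vn0; rewrite paddr_eq0 ?psd // => /andP[/eqP vAv yy].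
have Bv0 : B^T *m v = 0.
  have /eqP : y == 0 by apply: contraTT yy => /pos; rewrite lt_def => /andP[].
  by rewrite /y => /(congr1 (mulmx S)); rewrite mulKVmx // mulmx0.
by apply/eqP; apply: ker0 => //; apply: possemidef_ker.
Qed.

Lemma schur_posdef (R : realType) (n : nat -> nat) (k : nat)
    (A : forall j : nat, 'M[R]_(n j)) (B : forall j : nat, 'M[R]_(n j, n j.-1)) :
  posdefmx (A 0%N) ->
  (forall j : nat, (1 <= j <= k)%N -> possemidefmx (A j)) ->
  (forall j : nat, (1 <= j <= k)%N ->
      forall v : 'cV[R]_(n j), A j *m v = 0 -> (B j)^T *m v = 0 -> v = 0) ->
  forall j, (j <= k)%N -> posdefmx (schur A B j).
Proof.
move=> A0 Apsd ker0; elim=> [//|j IHj] jk /=.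
by apply: schur_posdef_step; [apply: IHj; apply: ltnW | apply: Apsd | apply: ker0].
Qed.

(** * Eigenvalues of a symmetric-definite pencil *)

(** A left eigenvector u of H^-1 S gives y = u H^-1 with y S = w (y H). Then
    y S y^t = w (y H y^t), with y^t the conjugate transpose, where the left
    side is real because S is symmetric and y H y^t is a positive real. The
    computation is carried out on the real and imaginary parts a and b of y. *)
Lemma pencil_eigenvalue_real (R : realType) m (H S : 'M[R]_m) (w : R[i]) :
  posdefmx H -> S \is symmetricmx -> eigenvalueC (invmx H *m S) w ->
  complex.Im w = 0.
Proof.
move=> Hpos /symmetricmxP symS; have Hu := posdef_unitmx Hpos.
case: Hpos => [/symmetricmxP symH pos].
case/eigenvalueP => u uE un0.
rewrite map_mxM map_invmx mulmxA in uE.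
set Hc := map_mx _ H in uE *; set Sc := map_mx _ S in uE *.
have Hcu : Hc \in unitmx by rewrite map_unitmx.
set y := u *m invmx Hc in uE.
have uy : u = y *m Hc by rewrite /y mulmxKV.
have yn0 : y != 0 by apply: contraNneq un0 => y0; rewrite uy y0 mul0mx.
rewrite uy in uE.
pose a := map_mx (@complex.Re R) y; pose b := map_mx (@complex.Im R) y.
have yE : y = map_mx (real_complex R) a + 'i *: map_mx (real_complex R) b.
  by apply/rowP => j; rewrite !mxE -complexE.
have yM (T : 'M[R]_m) : y *m map_mx (real_complex R) T
    = map_mx (real_complex R) (a *m T) + 'i *: map_mx (real_complex R) (b *m T).
  by rewrite yE mulmxDl -scalemxAl !map_mxM.
have eqj j : (a *m S) 0 j = complex.Re w * (a *m H) 0 j - complex.Im w * (b *m H) 0 j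
    /\ (b *m S) 0 j = complex.Re w * (b *m H) 0 j + complex.Im w * (a *m H) 0 j.
  have /rowP/(_ j) := uE; rewrite /Sc /Hc !yM.
  move: (a *m S) (b *m S) (a *m H) (b *m H) => aS bS aH bH.
  by case: (w) => ? ?; rewrite !mxE; simpc => -[-> ->].
set r := complex.Re w in eqj; set s := complex.Im w in eqj *.
have reE : a *m S = r *: (a *m H) - s *: (b *m H).
  apply/rowP => j; have [+ _] := eqj j.
  by move: (a *m S) (a *m H) (b *m H) => ? ? ?; rewrite !mxE.
have imE : b *m S = r *: (b *m H) + s *: (a *m H).
  apply/rowP => j; have [_ +] := eqj j.
  by move: (b *m S) (a *m H) (b *m H) => ? ? ?; rewrite !mxE.
have swap (T : 'M[R]_m) (c d : 'rV[R]_m) : T^T = T ->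
    (c *m T *m d^T) 0 0 = (d *m T *m c^T) 0 0.
  move=> symT; rewrite -[in LHS](trmxK (c *m T *m d^T)) mxE.
  by rewrite !trmx_mul trmxK symT mulmxA.
pose q (c : 'rV[R]_m) := (c *m H *m c^T) 0 0.
(* The imaginary part of y S y^t is (b S a^T - a S b^T), hence zero; that of
   w (y H y^t) is Im w times the sum of the forms of H at a and at b. *)
have sq0 : s * (q a + q b) = 0.
  have := swap S a b symS.
  rewrite reE imE !mulmxDl mulNmx -!scalemxAl.
  have addE (U V : 'M[R]_1) : (U + V) 0 0 = U 0 0 + V 0 0 by rewrite mxE.
  have oppE (U : 'M[R]_1) : (- U) 0 0 = - U 0 0 by rewrite mxE.
  have scaleE t (U : 'M[R]_1) : (t *: U) 0 0 = t * U 0 0 by rewrite mxE.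
  rewrite !(addE, oppE, scaleE) (swap H a b symH) -/(q a) -/(q b) => eq.
  lra.
have q_ge0 c : 0 <= q c.
  rewrite /q; have [->|cn0] := eqVneq c 0; first by rewrite mul0mx mul0mx mxE.
  by apply: ltW; have := pos c^T; rewrite trmxK; apply; rewrite trmx_eq0.
have q_eq0 c : q c = 0 -> c = 0.
  move=> qc; apply/eqP; apply: contraTT isT => cn0.
  by have := pos c^T; rewrite trmxK -/(q c) qc ltxx trmx_eq0; apply.
apply/eqP; apply: contraNT yn0 => sn0.
move/eqP: sq0; rewrite mulf_eq0 (negPf sn0) /= paddr_eq0 //.
by move=> /andP[/eqP/q_eq0 a0 /eqP/q_eq0 b0]; rewrite yE a0 b0 !map_mx0 scaler0 addr0.
Qed.

Lemma eigenvalue_range (R : realType) m (M : 'M[R]_m) (z : R[i]) :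
  (forall w, eigenvalueC M w -> complex.Im w = 0) ->
  eigenvalueC M z -> in_eigenvalue_range M z.
Proof.
move=> realM zM.
have [rs rsE] := closed_field_poly_normal (char_poly (map_mx (real_complex R) M)).
have rsP w : eigenvalueC M w = (w \in rs).
  rewrite /eigenvalueC eigenvalue_root_char rsE rootZ ?root_prod_XsubC //.
  by rewrite (monicP (char_poly_monic _)) oner_eq0.
have rs_gt0 : (index z rs < size rs)%N by rewrite index_mem -rsP.
(* The multiset of eigenvalues is nonempty, as it contains z, so the extrema
   are taken over its indices. *)
pose f (i : 'I_(size rs)) := complex.Re rs`_i.
have fE i : (f i)%:C = rs`_i.
  have /realM : eigenvalueC M rs`_i by rewrite rsP mem_nth.
  by rewrite /f; case: (rs`_i) => r s /= ->.
have [lo _ loP] := arg_minP f (isT : predT (Ordinal rs_gt0)).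
have [hi _ hiP] := arg_maxP f (isT : predT (Ordinal rs_gt0)).
have inrange w : eigenvalueC M w -> (f lo)%:C <= w <= (f hi)%:C.
  rewrite rsP => wrs; have wi : (index w rs < size rs)%N by rewrite index_mem.
  have <- : (f (Ordinal wi))%:C = w by rewrite fE /= nth_index.
  by rewrite !lecR loP // [_ <= f hi]hiP.
exists (f lo), (f hi); split; rewrite ?rsP ?fE ?mem_nth //.
  by move=> w; rewrite -!fE; apply: inrange.
by rewrite -!fE inrange.
Qed.

(** * Block diagonal matrices *)

Lemma map_mxdiag (aR rR : nzRingType) (f : {rmorphism aR -> rR}) p
    (q : 'I_p -> nat) (D : forall i, 'M[aR]_(q i)) :
  map_mx f (\mxdiag_i D i) = \mxdiag_i map_mx f (D i).
Proof.
have blockE i j (s : 'I_(q i)) (t : 'I_(q j)) :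
    f ((if i == j then conform_mx 0 (D i) else 0) s t)
    = (if i == j then conform_mx 0 (map_mx f (D i)) else 0) s t.
  by case: eqVneq t => [<-|_] t; rewrite ?conform_mx_id !mxE ?rmorph0.
by apply/matrixP => s t; rewrite !mxE blockE.
Qed.

Lemma eigenvalue_mxdiag (F : fieldType) p (q : 'I_p -> nat)
    (D : forall i, 'M[F]_(q i)) z :
  eigenvalue (\mxdiag_i D i) z -> exists i, eigenvalue (D i) z.
Proof.
case/eigenvalueP => v vE vn0.
have vD i : submxrow v i *m D i = z *: submxrow v i.
  move: vE; rewrite -[v in LHS]submxrowK mul_mxrow_mxdiag.
  move=> /(congr1 (fun u => submxrow u i)).
  by rewrite mxrowK => ->; apply/matrixP => s t; rewrite !mxE.
have [i vi] : exists i, submxrow v i != 0.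
  apply/existsP; apply: contraNT vn0; rewrite negb_exists => /forallP v0.
  rewrite -[v]submxrowK; apply/eqP/mxrowP => i; rewrite mxrowK submxrow0.
  by have := v0 i; rewrite negbK => /eqP.
by exists i; apply/eigenvalueP; exists (submxrow v i).
Qed.

Lemma invmx_mxdiag (F : fieldType) p (q : 'I_p -> nat)
    (D : forall i, 'M[F]_(q i)) :
  (forall i, D i \in unitmx) ->
  \mxdiag_i D i \in unitmx /\ invmx (\mxdiag_i D i) = \mxdiag_i invmx (D i).
Proof.
move=> Du.
have DV : \mxdiag_i D i *m \mxdiag_i invmx (D i) = 1%:M.
  rewrite [X in _ *m X]/mxdiag mul_mxdiag_mxblock -(mxdiagZ 1); apply: eq_mxblock => i j.
  by case: eqVneq => [->|]; rewrite ?conform_mx_id ?mulmx0 ?mulmxV.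
have [Dun _] := mulmx1_unit DV; split=> //.
by rewrite -[RHS](mulKmx Dun) DV mulmx1.
Qed.

Lemma eigenvalue_similar (F : fieldType) m (M U : 'M[F]_m) z :
  U \in unitmx -> eigenvalue (invmx U *m M *m U) z -> eigenvalue M z.
Proof.
move=> Uu; have Vu : invmx U \in unitmx by rewrite unitmx_inv.
rewrite -conjVmx //; apply: eigenvalue_conjmx; last by rewrite row_free_unit.
by rewrite submx_full // row_full_unit.
Qed.

(** * The common block bidiagonal factor *)

Lemma lower_bidiag_block_diag (R : realType) (n : nat -> nat)
    (D : forall j : nat, 'M[R]_(n j)) (B : forall j : nat, 'M[R]_(n j, n j.-1)) i :
  lower_bidiag_block D B i i = (-1) ^+ i *: D i.
Proof. by rewrite /lower_bidiag_block eqxx conform_mx_id. Qed.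

Lemma lower_bidiag_block_sub (R : realType) (n : nat -> nat)
    (D : forall j : nat, 'M[R]_(n j)) (B : forall j : nat, 'M[R]_(n j, n j.-1)) i :
  lower_bidiag_block D B i.+1 i = B i.+1.
Proof.
by rewrite /lower_bidiag_block gtn_eqF // eqxx conform_mx_id.
Qed.

Lemma lower_bidiag_block0 (R : realType) (n : nat -> nat)
    (D : forall j : nat, 'M[R]_(n j)) (B : forall j : nat, 'M[R]_(n j, n j.-1)) i j :
  i != j -> i != j.+1 -> lower_bidiag_block D B i j = 0.
Proof. by rewrite /lower_bidiag_block => /negPf -> /negPf ->. Qed.

(** The block product with L is a two-term sum. The family X is indexed by all
    of nat, and the second term is switched off by a multiplicity at i = 0, so
    that no cast is needed on the predecessor index. *)
Lemma lower_bidiag_row (R : realType) (n : nat -> nat)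
    (D : forall j : nat, 'M[R]_(n j)) (B : forall j : nat, 'M[R]_(n j, n j.-1))
    k p (X : forall j : nat, 'M[R]_(n j, p)) i : (i <= k)%N ->
  \sum_(j < k.+1) lower_bidiag_block D B i j *m X j
  = (-1) ^+ i *: (D i *m X i) + (B i *m X i.-1) *+ (0 < i)%N.
Proof.
move=> ik; have ik1 : (i < k.+1)%N by [].
rewrite (bigD1 (Ordinal ik1)) //= lower_bidiag_block_diag scalemxAl; congr (_ + _).
case: i ik ik1 => [|i] ik ik1 /=.
  rewrite big1 // => j jn0; rewrite lower_bidiag_block0 ?mul0mx //.
  by rewrite eq_sym.
have ik2 : (i < k.+1)%N by apply: ltnW.
rewrite mulr1n (bigD1 (Ordinal ik2)) /=; last by rewrite -val_eqE /= ltn_eqF.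
rewrite lower_bidiag_block_sub big1 ?addr0 // => j /andP[j1 j2].
by rewrite lower_bidiag_block0 ?mul0mx // ?eqSS eq_sym.
Qed.

(** Forward substitution: L x = 0 forces x_0 = 0, then x_1 = 0, and so on. *)
Lemma precondL_unit (R : realType) (n : nat -> nat)
    (D : forall j : nat, 'M[R]_(n j)) (B : forall j : nat, 'M[R]_(n j, n j.-1)) k :
  (forall j, (j <= k)%N -> D j \in unitmx) ->
  precondL D B k \in unitmx.
Proof.
move=> Du; apply: unitmx_ker0 => x.
rewrite -[x in LHS]submxcolK mul_mxblock_mxrow => Lx0.
(* The blocks of x, extended by 0 to all indices in nat as [lower_bidiag_row]
   and the induction on the block index require. *)
pose X j : 'cV[R]_(n j) :=
  if insub j is Some i then conform_mx 0 (submxcol x (i : 'I_k.+1)) else 0.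
have XE (i : 'I_k.+1) : X i = submxcol x i by rewrite /X valK conform_mx_id.
have rowE i : (i <= k)%N ->
    (-1) ^+ i *: (D i *m X i) + (B i *m X i.-1) *+ (0 < i)%N = 0.
  move=> ik; rewrite -(lower_bidiag_row D B X ik).
  have := congr1 (fun u => submxcol u (Ordinal (ik : (i < k.+1)%N))) Lx0.
  rewrite mxcolK submxcol0 /= => Lxi; rewrite -[RHS]Lxi.
  by apply: eq_bigr => j _; rewrite XE.
have X0 j : (j <= k)%N -> X j = 0.
  elim: j => [|j IHj] jk.
    have := rowE 0%N jk; rewrite addr0 expr0 scale1r => D0.
    by rewrite -(mulKmx (Du _ jk) (X 0%N)) D0 mulmx0.
  have := rowE _ jk; rewrite /= IHj ?(ltnW jk) // mulmx0 addr0 => DX0.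
  move/eqP: DX0; rewrite scaler_eq0 signr_eq0 => /eqP DX0.
  by rewrite -(mulKmx (Du _ jk) (X _)) DX0 mulmx0.
rewrite -[x]submxcolK; apply/mxcolP => i; rewrite mxcolK submxcol0 -XE.
by rewrite X0 // -ltnS.
Qed.

(** D agrees with the Schur complements except possibly in block k, so the
    blocks (-1)^j D_j^-1 S_j D_j^-1 in the middle are (-1)^j S_j^-1 for j < k;
    this makes the off-diagonal blocks of the product equal to B_j. *)
Lemma saddle_factor (R : realType) (n : nat -> nat) (k : nat)
    (D A : forall j : nat, 'M[R]_(n j)) (B : forall j : nat, 'M[R]_(n j, n j.-1)) :
  (forall j, (j <= k)%N -> (D j)^T = D j) ->
  (forall j, (j <= k)%N -> D j \in unitmx) ->
  (forall j, (j < k)%N -> D j = schur A B j) ->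
  saddle_mx A B k = precondL D B k *m
    (\mxdiag_(j < k.+1) ((-1) ^+ j *: (invmx (D j) *m schur A B j *m invmx (D j))))
    *m (precondL D B k)^T.
Proof.
move=> Dsym Du DS.
pose E j := (-1) ^+ j *: (invmx (D j) *m schur A B j *m invmx (D j)).
have ED j : (j < k)%N -> E j *m D j = (-1) ^+ j *: 1%:M.
  by move=> jk; rewrite -scalemxAl mulmxKV -?DS ?mulVmx // Du // ltnW.
have DE j : (j < k)%N -> D j *m E j = (-1) ^+ j *: 1%:M.
  by move=> jk; rewrite -scalemxAr mulmxA mulKVmx -?DS ?mulmxV // Du // ltnW.
have DED j : (j <= k)%N -> D j *m E j *m D j = (-1) ^+ j *: schur A B j.
  move=> jk; rewrite -scalemxAr -scalemxAl !mulmxA mulmxV ?Du //.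
  by rewrite mul1mx mulmxKV ?Du.
rewrite -mulmxA tr_mxblock mul_mxdiag_mxblock mul_mxblock.
apply: eq_mxblock => i l.
pose X j := E j *m (lower_bidiag_block D B l j)^T.
have [ik lk] : (i <= k)%N /\ (l <= k)%N by split; rewrite -ltnS.
rewrite (lower_bidiag_row D B X ik) /X {X}.
case: i l ik lk => [i _] [l _] /= ik lk.
(* The block in position (i, l) is now
   (-1)^i D_i E_i L_(l,i)^T + B_i E_(i-1) L_(l,i-1)^T, the second term being
   present only for i > 0. *)
rewrite /saddle_block; case: (eqVneq i l) => [<-|il].
  rewrite conform_mx_id lower_bidiag_block_diag linearZ /= Dsym //.
  rewrite -!scalemxAr scalerA -expr2 sqrr_sign scale1r mulmxA DED //.
  case: i ik => [|i] ik; first by rewrite addr0.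
  rewrite /= lower_bidiag_block_sub /E -DS // mulVmx ?Du 1?ltnW // mul1mx.
  rewrite -scalemxAl -scalemxAr exprS mulN1r scalerDr !scaleNr !mulmxA.
  by rewrite addrNK.
case: (eqVneq i l.+1) => [eil|il1].
  move: eil ik il => -> ik il.
  rewrite conform_mx_id lower_bidiag_block0 ?trmx0 ?mulmx0 ?scaler0 ?add0r //; last 2 first.
  - by rewrite ltn_eqF.
  - by rewrite ltn_eqF.
  rewrite /= lower_bidiag_block_diag linearZ /= Dsym // -scalemxAr ED //.
  by rewrite scalerA -expr2 sqrr_sign scale1r mulmx1.
case: (eqVneq l i.+1) => [eli|li1].
  move: eli lk il il1 => -> lk il il1.
  rewrite conform_mx_id lower_bidiag_block_sub mulmxA DE //.
  rewrite -scalemxAl scalerA -expr2 sqrr_sign scale1r mul1mx.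
  case: i ik {il il1 lk} => [|i] ik; first by rewrite addr0.
  by rewrite /= lower_bidiag_block0 ?trmx0 ?mulmx0 ?addr0 // ?eqSS gtn_eqF // ltnW.
rewrite (@lower_bidiag_block0 _ _ D B l i) // 1?eq_sym //.
rewrite trmx0 !mulmx0 scaler0 add0r.
case: i ik il il1 {li1} => [//|i] ik il il1.
by rewrite /= lower_bidiag_block0 ?trmx0 ?mulmx0 // eq_sym.
Qed.

(** * The spectrum of the preconditioned matrix *)

(** The change of basis U = diag(D_j)^-1 L^T turns the preconditioned matrix
    into the block diagonal matrix with blocks (-1)^j D_j^-1 S_j. *)
Lemma eigenvalue_precond_saddle (R : realType) (n : nat -> nat) (k : nat)
    (D A : forall j : nat, 'M[R]_(n j)) (B : forall j : nat, 'M[R]_(n j, n j.-1)) z :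
  (forall j, (j <= k)%N -> (D j)^T = D j) ->
  (forall j, (j <= k)%N -> D j \in unitmx) ->
  (forall j, (j < k)%N -> D j = schur A B j) ->
  eigenvalueC (invmx (precond D B k) *m saddle_mx A B k) z ->
  exists2 j, (j <= k)%N & eigenvalueC ((-1) ^+ j *: (invmx (D j) *m schur A B j)) z.
Proof.
move=> Dsym Du DS.
have Lu := precondL_unit B Du.
have [diagu diagV] : precondD D k \in unitmx /\
    invmx (precondD D k) = \mxdiag_(j < k.+1) invmx (D j).
  by apply: invmx_mxdiag => j; apply: Du; rewrite -ltnS.
pose M := \mxdiag_(j < k.+1) ((-1) ^+ j *: (invmx (D j) *m schur A B j)).
pose U := invmx (precondD D k) *m (precondL D B k)^T.
have Uu : U \in unitmx by rewrite unitmx_mul unitmx_inv diagu unitmx_tr.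
have -> : invmx (precond D B k) *m saddle_mx A B k = invmx U *m M *m U.
  have saddleE : saddle_mx A B k = precondL D B k *m M *m U.
    rewrite (saddle_factor Dsym Du DS) /U diagV -!mulmxA; congr (_ *m _).
    rewrite !mulmxA; congr (_ *m _); rewrite /M [X in _ = _ *m X]/mxdiag.
    rewrite mul_mxdiag_mxblock /mxdiag; apply: eq_mxblock => i j.
    by case: eqVneq => [->|]; rewrite ?mulmx0 // !conform_mx_id scalemxAl.
  have precondE : precond D B k = precondL D B k *m U by rewrite /U mulmxA.
  have Pu : precond D B k \in unitmx by rewrite precondE unitmx_mul Lu.
  rewrite saddleE -[RHS](mulKmx Pu); congr (_ *m _).
  rewrite precondE -(mulmxA (precondL D B k) U) -(mulmxA (invmx U)).
  by rewrite (mulKVmx Uu) (mulmxA _ M U).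
have simU (V N : 'M[R]_(\sum_(j < k.+1) n j)) : V \in unitmx ->
    eigenvalueC (invmx V *m N *m V) z -> eigenvalueC N z.
  move=> Vu; rewrite /eigenvalueC !map_mxM map_invmx.
  by apply: eigenvalue_similar; rewrite map_unitmx.
move=> /(simU _ _ Uu); rewrite /eigenvalueC /M.
rewrite map_mxdiag => /eigenvalue_mxdiag[j zj].
by exists (j : nat); rewrite // -ltnS.
Qed.

Theorem theorem2 (R : realType) (k : nat) (hk : (1 <= k)%N) (n : nat -> nat)
    (hn : forall j : nat, (j <= k)%N -> (0 < n j)%N)
    (A : forall j : nat, 'M[R]_(n j))
    (B : forall j : nat, 'M[R]_(n j, n j.-1))
    (hA0 : posdefmx (A 0%N))
    (hA : forall j : nat, (1 <= j <= k)%N -> possemidefmx (A j))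
    (hker : forall j : nat, (1 <= j <= k)%N ->
      forall v : 'cV[R]_(n j), A j *m v = 0 -> (B j)^T *m v = 0 -> v = 0)
    (Shat : 'M[R]_(n k)) (hShat : posdefmx Shat)
    (z : R[i])
    (hz : eigenvalueC (invmx (precond_hat A B Shat) *m saddle_mx A B k) z) :
  [\/ z = 1, z = -1
    | in_eigenvalue_range ((-1) ^+ k *: (invmx Shat *m schur A B k)) z].
Proof.
have Spos := schur_posdef hA0 hA hker.
set D := dfwith (schur A B) Shat.
have Dk : D k = Shat by apply: dfwith_in.
have DS j : (j < k)%N -> D j = schur A B j.
  by move=> jk; rewrite /D dfwith_out // gtn_eqF.
have Dpos j : (j <= k)%N -> posdefmx (D j).
  rewrite leq_eqVlt => /predU1P[->|jk]; first by rewrite Dk.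
  by rewrite DS //; apply: Spos; apply: ltnW.
have Du j : (j <= k)%N -> D j \in unitmx by move=> /Dpos/posdef_unitmx.
have Dsym j : (j <= k)%N -> (D j)^T = D j by move=> /Dpos[/symmetricmxP].
have [j] := eigenvalue_precond_saddle Dsym Du DS hz.
rewrite leq_eqVlt => /predU1P[->|jk].
  rewrite Dk => zk; apply: Or33; apply: eigenvalue_range => // w.
  rewrite scalemxAr; apply: pencil_eigenvalue_real => //.
  have [/symmetricmxP symS _] := Spos k (leqnn k).
  by apply/symmetricmxP; rewrite linearZ /= symS.
(* For j < k the block is (-1)^j times the identity. *)
rewrite -DS // mulVmx ?Du 1?ltnW //.
case/eigenvalueP => v; rewrite map_mxZ map_mx1 -scalemxAr mulmx1 => vE vn0.
have : z = (-1) ^+ j.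
  apply/eqP; rewrite eq_sym -subr_eq0.
  have : (((-1) ^+ j - z) *: v == 0) by rewrite scalerBl -vE rmorphXn rmorphN1 subrr.
  by rewrite scaler_eq0 (negPf vn0) orbF.
rewrite -signr_odd; case: (odd j) => ->; [exact: Or32 | exact: Or31].
Qed.
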